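(* Let $q$ be a prime power. (a) For every $n_0$ there exists a $k$-regular graph $G$ of order $n>n_0$ such that $$k=\frac{q-1}{q}\,n+\frac1q$$ and $$\|G\|_*=k+\sqrt{k(n-k)(n-1)}.$$ (b) For every $n_0$ there exists a $k$-regular graph $G$ of order $n>n_0$ such that $$k=\frac{n}{q}-\frac{q+1}{q}$$ and $$\|G\|_*>\sqrt{k(n-k)n}-n+k+1.$$
   Context: Graphs are finite, simple and undirected; the order of a graph is its number of vertices. The energy $\|G\|_*$ of a graph $G$ is the sum of the absolute values of the eigenvalues of its adjacency matrix (counted with multiplicity). *)

(* Defs.v *)
From HB Require Import structures.
From mathcomp Require Import all_boot all_order all_algebra.
From mathcomp Require Import polyrcf.
From mathcomp Require Import reals.

Set Implicit Arguments.
Unset Strict Implicit.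
Unset Printing Implicit Defensive.

Import Order.TTheory GRing.Theory Num.Theory.
Local Open Scope ring_scope.

Definition prime_power (q : nat) : Prop :=
  exists p a : nat, [/\ prime p, (0 < a)%N & q = (p ^ a)%N].

Record sgraph : Type := SGraph {
  vertex : finType;
  adj : rel vertex;
  adj_sym : symmetric adj;
  adj_irrefl : irreflexive adj
}.

Definition graph_order (G : sgraph) : nat := #|vertex G|.

Definition graph_regular (k : nat) (G : sgraph) : Prop :=
  forall x : vertex G, #|[set y | adj x y]| = k.

Definition adjacency (R : realType) (G : sgraph) : 'M[R]_(graph_order G) :=
  \matrix_(i, j) (adj (enum_val i : vertex G) (enum_val j))%:R.

(* [rootsR] lists each real root of the characteristic polynomial once; [mup]
   is its multiplicity. The adjacency matrix is symmetric, so all its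
   eigenvalues are real and none is missed. *)
Definition energy (R : realType) (G : sgraph) : R :=
  let p := char_poly (adjacency R G) in
  \sum_(x <- rootsR p) `|x| *+ mup x p.

(* Main.v *)
Require Import Defs.
From HB Require Import structures.
From mathcomp Require Import all_boot all_order all_algebra all_field.
From mathcomp Require Import polyrcf.
From mathcomp Require Import reals.
From mathcomp Require Import ring lra zify.

Set Implicit Arguments.
Unset Strict Implicit.
Unset Printing Implicit Defensive.

Import Order.TTheory GRing.Theory Num.Theory.
Local Open Scope ring_scope.

(** The graph of (a) has the points of the projective space PG(2m-1, q) as
vertices, two points being adjacent when a symplectic form [B] does not vanish
on them; the graph of (b) is its complement.  As [B] is alternating, no point
is adjacent to itself, and as [B] is nondegenerate, counting the fibres of the
surjective linear maps [B x] and [(B x, B z)] gives, with [s = q^(m-1)],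
  [n = (q^(2m) - 1)/(q - 1)],  [k = q s^2],
and [l = (q - 1) s^2] common neighbours for {e any} two distinct vertices
([symplectic_graph]).  The adjacency matrix [A] thus satisfies
[A^2 = s^2 I + l J] and [A J = k J], where [J] is the all-ones matrix.  The
complement has adjacency matrix [J - I - A], and [N = J - A] satisfies
equations of the same form: [N^2 = s^2 I + (n - 2k + l) J] and
[N J = (n - k) J].

Both cases are instances of one computation ([spectral_norm_design]).  Suppose
that [A] has trace 0 and that [N = A + e I] satisfies [N^2 = s^2 I + mu J] and
[N J = K J].  Then [N] is annihilated by [(X - K)(X - s)(X + s)], which has
simple roots, so that [A] is diagonalizable with eigenvalues among [K - e],
[s - e] and [- s - e].  Their multiplicities need not be computed: on these
three numbers the absolute value agrees with a polynomial of degree 2, so the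
energy is a linear combination of [n], [tr A = 0] and [tr A^2].  The result is
  [K - e + (n - 1) s - e (e n - K) / s].

For (a), [e = 0] and [K = k] give [k + (n - 1) s], and
[k (n - k) = s^2 (n - 1)].  For (b), [e = 1] and [K = n - k] give
[k' + (n - 1) s - q s] where [k' = n - k - 1] is the degree of the complement,
and for [s >= 2] the bound reduces to an inequality between polynomials in [q]
and [s] ([complement_energy_bound]). *)

(** * Spectrum and energy *)

Lemma char_poly_simmx (F : fieldType) n (P A B : 'M[F]_n) :
  P \in unitmx -> P *m A = B *m P -> char_poly A = char_poly B.
Proof.
move=> Pu PA; pose Q := map_mx polyC P.
have Q0 : \det Q != 0.
  by rewrite det_map_mx polyC_eq0 -unitfE -unitmxE.
apply: (mulfI Q0); rewrite [RHS]mulrC -!det_mulmx; congr (\det _).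
rewrite mulmxBr mulmxBl mul_mx_scalar mul_scalar_mx; congr (_ - _).
by rewrite -!map_mxM PA.
Qed.

(** The form in which diagonalizability is used: the trace of every polynomial
of degree at most 2 in [A] becomes a sum over the eigenvalues. *)
Lemma diagonalizable_spectrum (F : fieldType) n (A : 'M[F]_n.+1) (rs : seq F) :
    uniq rs -> horner_mx A (\prod_(x <- rs) ('X - x%:P)) = 0 ->
  exists d : 'rV[F]_n.+1,
    [/\ char_poly A = \prod_i ('X - (d 0 i)%:P),
        forall i, d 0 i \in rs,
        \tr A = \sum_i d 0 i
      & \tr (A *m A) = \sum_i d 0 i ^+ 2].
Proof.
move=> rs_uniq A0; have mins := mxminpoly_min A0.
have [P Pu /diagonalizable_forPex[d /(simmxP Pu) PA]] :
  diagonalizable A by apply/diagonalizableP; exists rs.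
have AE : A = invmx P *m (diag_mx d *m P) by rewrite -PA mulKmx.
have cpE : char_poly A = \prod_i ('X - (d 0 i)%:P).
  rewrite (char_poly_simmx Pu PA) char_poly_trig ?diag_mx_is_trig //.
  by apply: eq_bigr => i _; rewrite mxE eqxx mulr1n.
exists d; split=> // [i||].
- rewrite -root_prod_XsubC; have /dvdpP[c ->] := mins; rewrite rootM orbC.
  rewrite root_mxminpoly cpE.
  by rewrite rootE horner_prod (bigD1 i) //= hornerXsubC subrr mul0r eqxx.
- by rewrite AE mxtrace_mulC mulmxK // mxtrace_diag.
- rewrite {1}AE -mulmxA -[X in _ *m X]mulmxA PA mxtrace_mulC.
  rewrite -!mulmxA mulmxV // mulmx1.
  by rewrite mulmx_diag mxtrace_diag; apply: eq_bigr => i _; rewrite !mxE.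
Qed.

(** For a polynomial that splits over the real closed field, real roots with
multiplicities are all the roots; this turns the definition of the energy into
a sum over a spectrum. *)
Lemma sum_rootsR (R : rcfType) (f : R -> R) (s : seq R) :
  let p := \prod_(y <- s) ('X - y%:P) in
  \sum_(x <- rootsR p) f x *+ mup x p = \sum_(y <- s) f y.
Proof.
move=> p; have p0 : p != 0 by rewrite monic_neq0 // monic_prod_XsubC.
transitivity (\sum_(x <- undup s) f x *+ count_mem x s); last first.
  by rewrite -[RHS]big_undup_iterop_count; apply: eq_bigr.
rewrite (perm_big (undup s)) /=.
  by apply: eq_bigr => x _; rewrite mu_prod_XsubC.
apply: uniq_perm; rewrite ?undup_uniq ?uniq_roots // => x.
by rewrite -roots_on_rootsR // mem_undup -root_prod_XsubC in_itv.
Qed.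

Lemma const_mx_scale (R : pzRingType) m n (a : R) :
  const_mx a = a *: const_mx 1 :> 'M_(m, n).
Proof. by rewrite scalemx_const mulr1. Qed.

(** The three eigenvalues are [K - e], [s - e] and [- s - e], and the hypotheses
on [e] decide their signs.  The proof interpolates the absolute value by the
quadratic polynomial
  [s - (e / s) (x + e) + g ((x + e)^2 - s^2)],
where [g] is fixed by the value at [K - e].  Since [K^2 - s^2 = n mu], the
contribution of [mu] to the trace of [A^2] cancels the denominator of [g]. *)
Lemma spectral_norm_design (R : realType) n (A : 'M[R]_n) (e K s mu : R) :
    let p := char_poly A in let N := A + e%:M in
    (0 < n)%N -> \tr A = 0 ->
    N *m N = (s ^+ 2)%:M + const_mx mu ->
    N *m const_mx 1 = const_mx K :> 'M_n ->
    0 <= e -> e <= s -> 0 < s -> s < K ->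
  \sum_(x <- rootsR p) `|x| *+ mup x p =
    K - e + (n%:R - 1) * s - e * (e * n%:R - K) / s.
Proof.
case: n A => // n A p N _ trA NN NJ e_ge0 le_es s_gt0 lt_sK.
have Nmu : N *m const_mx mu = const_mx (K * mu) :> 'M_n.+1.
  by rewrite const_mx_scale -scalemxAr NJ scalemx_const mulrC.
(* Both sides are read off from [N (N J)], computed in two ways. *)
have KsE : K ^+ 2 - s ^+ 2 = mu * n.+1%:R.
  have /matrixP/(_ 0 0) : N *m N *m const_mx 1 = const_mx (K ^+ 2) :> 'M_n.+1.
    by rewrite -mulmxA NJ const_mx_scale -scalemxAr NJ scalemx_const.
  rewrite NN mulmxDl mul_scalar_mx !mxE mulr1 => <-.
  under eq_bigr do rewrite !mxE mulr1.
  rewrite sumr_const card_ord -[mu *+ _]mulr_natr; ring.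
pose rs := [:: K - e; s - e; - s - e].
have shift x : A - (x - e)%:M = N - x%:M.
  by rewrite /N raddfB /= opprB addrCA addrA addrAC addrC addrA.
have rs_uniq : uniq rs.
  rewrite /= !inE !negb_or !andbT -!andbA; apply/and3P.
  by split; apply/eqP => h; lra.
have A0 : horner_mx A (\prod_(x <- rs) ('X - x%:P)) = 0.
  rewrite !big_cons big_nil mulr1 !rmorphM !rmorphB /= horner_mx_X !horner_mx_C.
  rewrite -!rmorphB /= !shift -!mulmxE.
  have -> : (N - s%:M) *m (N - (- s)%:M) = const_mx mu.
    rewrite mulmxBl !mulmxBr !mul_scalar_mx !mul_mx_scalar NN scale_scalar_mx.
    rewrite scaleNr mulrN -expr2 !opprK [(s ^+ 2)%:M + _]addrC opprB raddfN /=.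
    by rewrite addrACA subrr addr0 addrK.
  by rewrite mulmxBl Nmu mul_scalar_mx scalemx_const subrr.
have [d [pE d_rs sum_d sum_d2]] := diagonalizable_spectrum rs_uniq A0.
have trAA : \tr (A *m A) = n.+1%:R * (s ^+ 2 + mu - e ^+ 2).
  have -> : A = N - e%:M by rewrite /N addrK.
  rewrite mulmxBl !mulmxBr !mul_scalar_mx !mul_mx_scalar NN scale_scalar_mx.
  rewrite !raddfB /= mxtraceD mxtraceZ /N mxtraceD !mxtrace_scalar trA.
  have -> : \tr (const_mx mu : 'M_n.+1) = mu *+ n.+1.
    rewrite /mxtrace; under eq_bigr do rewrite mxE.
    by rewrite sumr_const card_ord.
  ring.
have -> : \sum_(x <- rootsR p) `|x| *+ mup x p = \sum_i `|d 0 i|.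
  rewrite /p pE -(big_map (d 0) xpredT (fun y => 'X - y%:P)) sum_rootsR.
  by rewrite big_map.
(* The interpolation coefficient of [(x + e)^2 - s^2]. *)
pose g := (K - e - s + e * K / s) / (K ^+ 2 - s ^+ 2).
have Ks0 : K ^+ 2 - s ^+ 2 != 0.
  by rewrite subr_sqr mulf_neq0 //; apply/eqP => h; lra.
have dE i : `|d 0 i| =
    (s - e ^+ 2 / s + g * (e ^+ 2 - s ^+ 2)) + (2 * e * g - e / s) * d 0 i
    + g * d 0 i ^+ 2.
  have s0 : s != 0 by rewrite gt_eqF.
  have := d_rs i; rewrite !inE => /or3P[] /eqP->.
  - rewrite ger0_norm; last lra.
    rewrite /g; field; by rewrite s0 Ks0.
  - rewrite ger0_norm; last lra.
    rewrite /g; field; by rewrite s0 Ks0.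
  - rewrite ler0_norm; last lra.
    rewrite /g; field; by rewrite s0 Ks0.
have sumE a b c : \sum_i (a + b * d 0 i + c * d 0 i ^+ 2) =
    n.+1%:R * a + c * \tr (A *m A).
  rewrite !big_split /= -!mulr_sumr -sum_d -sum_d2 trA mulr0 addr0.
  by rewrite sumr_const card_ord mulr_natl.
under eq_bigr do rewrite dE.
rewrite sumE trAA.
have -> : g * (n.+1%:R * (s ^+ 2 + mu - e ^+ 2)) =
  n.+1%:R * (g * (s ^+ 2 - e ^+ 2)) + g * (K ^+ 2 - s ^+ 2).
  by rewrite KsE; ring.
rewrite [g * (K ^+ 2 - _)]divfK //; field; exact: lt0r_neq0.
Qed.

(** * Adjacency matrices of a graph and of its complement *)

Section Adjacency.
Variables (R : realType) (G : sgraph).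
Local Notation A := (adjacency R G).

Lemma sum_enum_val (P : pred (vertex G)) :
  \sum_(i < graph_order G) (P (enum_val i))%:R = #|[set z | P z]|%:R :> R.
Proof.
rewrite -sum1_card natr_sum [RHS]big_mkcond /=.
rewrite (reindex _ (onW_bij _ (@enum_val_bij (vertex G)))) /=.
by apply: eq_bigr => i _; rewrite inE; case: (P _).
Qed.

Lemma adjacency_sqr i j :
  (A *m A) i j = #|[set z | adj (enum_val i) z && adj (enum_val j) z]|%:R.
Proof.
rewrite -sum_enum_val mxE; apply: eq_bigr => l _.
by rewrite !mxE [adj (enum_val l) _]adj_sym -natrM mulnb.
Qed.

Lemma adjacency_regular k : graph_regular k G ->
  A *m const_mx 1 = const_mx k%:R :> 'M_(graph_order G).
Proof.
move=> kG; apply/matrixP => i j; rewrite !mxE -(kG (enum_val i)) -sum_enum_val.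
by apply: eq_bigr => l _; rewrite !mxE mulr1.
Qed.

Lemma tr_adjacency : \tr A = 0.
Proof. by apply: big1 => i _; rewrite mxE adj_irrefl. Qed.

End Adjacency.

Lemma energy_design (R : realType) (G : sgraph) (e K s mu : R) :
    let n := graph_order G in let N := adjacency R G + e%:M in
    (0 < n)%N ->
    N *m N = (s ^+ 2)%:M + const_mx mu ->
    N *m const_mx 1 = const_mx K :> 'M_n ->
    0 <= e -> e <= s -> 0 < s -> s < K ->
  energy R G = K - e + (n%:R - 1) * s - e * (e * n%:R - K) / s.
Proof.
move=> n N n_gt0 NN NJ e_ge0 le_es s_gt0 lt_sK.
exact: (spectral_norm_design n_gt0 (tr_adjacency R G) NN NJ).
Qed.

Lemma adjacency_sqr_design (R : realType) (G : sgraph) (k l : nat) :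
    graph_regular k G ->
    (forall x y : vertex G, x != y -> #|[set z | adj x z && adj y z]| = l) ->
  adjacency R G *m adjacency R G = (k%:R - l%:R)%:M + const_mx l%:R.
Proof.
move=> kG lG; apply/matrixP => i j; rewrite adjacency_sqr !mxE.
have [->|ij] := eqVneq i j; last first.
  by rewrite lG ?add0r // (inj_eq enum_val_inj).
rewrite mulr1n subrK -(kG (enum_val j)); congr (_%:R).
by apply: eq_card => z; rewrite !inE andbb.
Qed.

Section Complement.
Variable G : sgraph.

Definition nonadj (x y : vertex G) := (x != y) && ~~ adj x y.

Lemma nonadj_sym : symmetric nonadj.
Proof. by move=> x y; rewrite /nonadj eq_sym adj_sym. Qed.

Lemma nonadj_irrefl : irreflexive nonadj.
Proof. by move=> x; rewrite /nonadj eqxx. Qed.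

Definition complement := SGraph nonadj_sym nonadj_irrefl.

Lemma complement_regular k :
  graph_regular k G -> graph_regular (graph_order G - k.+1) complement.
Proof.
move=> kG x; rewrite /graph_order -(kG x).
have -> : [set y | @adj complement x y] = ~: (x |: [set y | @adj G x y]).
  by apply/setP => y; rewrite !inE /= /nonadj negb_or [y == x]eq_sym.
have := cardsC (x |: [set y | @adj G x y]).
by rewrite cardsU1 inE adj_irrefl add1n => <-; rewrite addKn.
Qed.

Lemma adjacency_complement (R : realType) :
  adjacency R complement = const_mx 1 - 1%:M - adjacency R G.
Proof.
apply/matrixP => i j; rewrite !mxE /= /nonadj (inj_eq enum_val_inj).
case: eqVneq => [->|_] /=; first by rewrite adj_irrefl !subr0 subrr.
by rewrite subr0; case: adj; rewrite ?subrr ?subr0.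
Qed.

End Complement.

(** With [N = J - A] this is the expansion of the square, where [J A = A J]
because [A] is symmetric with constant row sums. *)
Lemma complement_adjacency_sqr (R : realType) (G : sgraph) (k l : nat) :
    graph_regular k G ->
    (forall x y : vertex G, x != y -> #|[set z | adj x z && adj y z]| = l) ->
  let N := adjacency R (complement G) + 1%:M in
  let n := (graph_order G)%:R in
  N *m N = (k%:R - l%:R)%:M + const_mx (n - k%:R *+ 2 + l%:R).
Proof.
move=> kG lG N n.
have AJ := adjacency_regular R kG; have AA := adjacency_sqr_design R kG lG.
set A := adjacency R G in AJ AA; pose J : 'M[R]_(graph_order G) := const_mx 1.
have JA : J *m A = const_mx k%:R.
  have AT : A^T = A by apply/matrixP => i j; rewrite !mxE adj_sym.
  by rewrite -[LHS]trmxK trmx_mul AT trmx_const AJ trmx_const.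
have JJ : J *m J = const_mx n.
  apply/matrixP => i j; rewrite !mxE; under eq_bigr do rewrite !mxE mulr1.
  by rewrite sumr_const card_ord.
have -> : N = J - A by rewrite /N adjacency_complement addrAC subrK.
rewrite mulmxBl !mulmxBr JJ JA AJ AA; apply/matrixP => i j; rewrite !mxE; ring.
Qed.

Lemma complement_adjacency_const (R : realType) (G : sgraph) (k : nat) :
    graph_regular k G ->
  let N := adjacency R (complement G) + 1%:M in
  let n := (graph_order G)%:R in
  N *m const_mx 1 = const_mx (n - k%:R) :> 'M_(graph_order G).
Proof.
move=> kG N n; rewrite /N adjacency_complement addrAC subrK mulmxBl.
rewrite (adjacency_regular R kG); apply/matrixP => i j; rewrite !mxE.
by under eq_bigr do rewrite !mxE mulr1; rewrite sumr_const card_ord.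
Qed.

(** * The symplectic graph *)

(** All fibres of a surjective additive map are translates of its kernel, hence
equally large; so preimages have the density of the sets they come from. *)
Lemma card_preim_additive (U W : finZmodType) (f : U -> W) (P : {pred W}) :
    {morph f : u v / u + v} -> (forall w, exists u, f u = w) ->
  (#|[pred u | f u \in P]| * #|W| = #|P| * #|U|)%N.
Proof.
move=> fD f_surj.
have fiber w : #|[pred u | f u == w]| = #|[pred u | f u == 0]|.
  have [u0 fu0] := f_surj w.
  rewrite -(card_image (addIr u0) [pred u | f u == 0]).
  apply: eq_card => u; rewrite inE; apply/eqP/imageP => [fu | [v]].
    exists (u - u0); last by rewrite subrK.
    by rewrite inE -(inj_eq (addIr (f u0))) -fD subrK add0r fu fu0.
  by rewrite inE => /eqP fv ->; rewrite fD fv fu0 add0r.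
have card_preim (Q : {pred W}) :
    #|[pred u | f u \in Q]| = (#|Q| * #|[pred u | f u == 0%R]|)%N.
  rewrite -sum1_card (partition_big f (mem Q)) //= -sum_nat_const.
  apply: eq_bigr => w Qw; rewrite -(fiber w) -sum1_card; apply: eq_bigl => u.
  by rewrite !inE andb_idl // => /eqP->.
rewrite (_ : #|U| = #|[pred u | f u \in predT]|); last exact: eq_card.
by rewrite !card_preim mulnAC -mulnA; congr (_ * (_ * _))%N; apply: eq_card.
Qed.

(* The target of the pair of forms [(B x, B z)], indexed by [bool]. *)
HB.instance Definition _ (I : finType) (W : finZmodType) :=
  GRing.Zmodule.on {ffun I -> W}.

Section Symplectic.
Variables (F : finFieldType) (m : nat).
Local Notation V := 'M[F]_(m, 2).
Local Notation q := #|F|.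

(** Points of the projective space are represented by the nonzero vectors whose
first nonzero entry, in the order of enumeration of the index pairs, is 1.
[lead] is that entry; vectors are [m] by 2 matrices so that row [i] holds the
[i]-th hyperbolic pair of coordinates. *)
Definition lead (x : V) : F :=
  if [pick ij | x ij.1 ij.2 != 0] is Some ij then x ij.1 ij.2 else 0.

Lemma lead0 : lead 0 = 0.
Proof. by rewrite /lead; case: pickP => // ij; rewrite mxE. Qed.

Lemma lead_eq0 x : (lead x == 0) = (x == 0).
Proof.
apply/idP/eqP => [|->]; last by rewrite lead0.
rewrite /lead; case: pickP => [ij /negPf-> // | x0 _].
by apply/matrixP => i j; have /negbFE/eqP := x0 (i, j); rewrite mxE.
Qed.

Lemma leadZ c x : c != 0 -> lead (c *: x) = c * lead x.
Proof.
move=> c0; rewrite /lead.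
rewrite (@eq_pick _ (fun ij => (c *: x) ij.1 ij.2 != 0)
  (fun ij => x ij.1 ij.2 != 0)) => [|ij].
  2: by rewrite !mxE mulf_eq0 (negPf c0).
by case: pickP => [ij _|_]; rewrite ?mxE ?mulr0.
Qed.

(** Each vector of [P] is a unique multiple of a normalized one, by the scalar
[lead x]. *)
Lemma card_lead1 (P : {pred V}) :
    (forall c x, c != 0 -> (c *: x \in P) = (x \in P)) -> 0 \notin P ->
  (#|[pred x in P | lead x == 1%R]| * q.-1 = #|P|)%N.
Proof.
move=> PZ P0.
have n0 x : x \in P -> lead x != 0.
  by move=> Px; rewrite lead_eq0; apply: contraTneq Px => ->.
rewrite -[in RHS]sum1_card (partition_big lead (fun c => c != 0%R)) //=.
rewrite -(cardC1 (0 : F)) mulnC -sum_nat_const; apply: eq_bigr => c c0.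
rewrite sum1_card -(card_image (scalerI c0) [pred x in P | lead x == 1]).
apply: eq_card => x; rewrite -[RHS]topredE /=.
apply/imageP/andP => [[y]|[Px /eqP lx]].
  by rewrite inE => /andP[Py /eqP ly] ->; rewrite PZ // leadZ // ly mulr1.
exists (c^-1 *: x); last by rewrite scalerA divff ?scale1r.
by rewrite inE PZ ?invr_eq0 // Px leadZ ?invr_eq0 // lx mulVf ?eqxx.
Qed.

Definition sform (x y : V) : F := \sum_i (x i 0 * y i 1 - x i 1 * y i 0).

Lemma sformC x y : sform y x = - sform x y.
Proof. by rewrite /sform -sumrN; apply: eq_bigr => i _; ring. Qed.

Lemma sformxx x : sform x x = 0.
Proof. by rewrite /sform; apply: big1 => i _; ring. Qed.

Lemma sformDr x : {morph sform x : y z / y + z}.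
Proof.
move=> y z; rewrite /sform -big_split; apply: eq_bigr => i _.
by rewrite !mxE /=; ring.
Qed.

Lemma sformZr c x y : sform x (c *: y) = c * sform x y.
Proof.
by rewrite /sform mulr_sumr; apply: eq_bigr => i _; rewrite !mxE /=; ring.
Qed.

Lemma sform0r x : sform x 0 = 0.
Proof. by rewrite -[0 in LHS](scale0r 0) sformZr mul0r. Qed.

Lemma sform_nondegenerate x : (forall y, sform x y = 0) -> x = 0.
Proof.
move=> x0; apply/matrixP => i j; rewrite mxE.
(* Indices are added modulo 2: [1 - j] is the column other than [j]. *)
have := x0 (delta_mx i (1 - j)); rewrite /sform (bigD1 i) //= big1 => [|i' ii'].
  rewrite !mxE !eqxx addr0.
  have: j = 0 \/ j = 1 by case: j => -[|[|//]] ?; [left|right]; apply: val_inj.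
  case=> ->; rewrite ?subr0 ?subrr /=; rewrite ?mulr1 ?mulr0 ?subr0 ?add0r //.
  by move/eqP; rewrite oppr_eq0 => /eqP.
by rewrite !mxE (negPf ii') /= !mulr0 subr0.
Qed.

(** If [y0] is not orthogonal to [x] and [z' = z - c x] is chosen orthogonal to
[y0], then [z'] is nonzero, so some [y] is not orthogonal to it.  Subtracting
from [y] a multiple of [y0] makes it orthogonal to [x] without changing its
product with [z'], which is then also its product with [z]. *)
Lemma sform_dual x z : x != 0 -> (forall c, z != c *: x) ->
  exists y, sform x y = 0 /\ sform z y = 1.
Proof.
move=> x0 zNx.
have [y0 xy0] : exists y, sform x y != 0.
  apply/existsP; apply: contraNT x0 => /existsPn h.
  by apply/eqP/sform_nondegenerate => y; apply/eqP/negbNE/h.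
pose c := sform z y0 / sform x y0.
have [y zy] : exists y, sform (z - c *: x) y != 0.
  apply/existsP; apply: contraNT (zNx c) => /existsPn h; rewrite -subr_eq0.
  by apply/eqP/sform_nondegenerate => y; apply/eqP/negbNE/h.
pose w := y - (sform x y / sform x y0) *: y0.
have xw : sform x w = 0.
  by rewrite /w sformDr -scaleNr sformZr; field.
have zw : sform z w != 0.
  rewrite (_ : sform z w = sform (z - c *: x) y) //.
  have -> : sform (z - c *: x) y = sform z y - c * sform x y.
    rewrite (sformC y) sformDr -scaleNr sformZr (sformC z y) (sformC x y); ring.
  by rewrite /w sformDr -scaleNr sformZr /c; field.
exists ((sform z w)^-1 *: w); rewrite !sformZr xw mulr0.
by rewrite mulVf.
Qed.

Definition point := {x : V | lead x == 1}.

Lemma point_neq0 (x : point) : val x != 0.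
Proof. by rewrite -lead_eq0 (eqP (valP x)) oner_neq0. Qed.

Lemma point_independent (x z : point) : x != z -> forall c, val z != c *: val x.
Proof.
move=> xz c; apply: contra_neq xz => zx; apply: val_inj.
have c0 : c != 0.
  by apply: contraNneq (point_neq0 z) => c0; rewrite zx c0 scale0r.
have := valP z; rewrite zx leadZ // (eqP (valP x)) mulr1 => /eqP c1.
by rewrite c1 scale1r.
Qed.

Lemma card_points (P : {pred V}) :
    (forall c x, c != 0 -> (c *: x \in P) = (x \in P)) -> 0 \notin P ->
  (#|[set x : point | val x \in P]| * q.-1 = #|P|)%N.
Proof.
move=> PZ P0; rewrite -(card_lead1 PZ P0) -(card_imset _ val_inj).
congr (_ * _)%N; apply: eq_card => x; rewrite inE.
apply/imsetP/andP => [[y]|[Px lx]].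
  by rewrite inE => Py ->; rewrite Py (valP y).
by exists (Sub x lx); rewrite ?inE SubK.
Qed.

Lemma card_point : ((#|{: point}| * q.-1).+1 = q ^ (m * 2))%N.
Proof.
have q0 : (0 < q ^ (m * 2))%N.
  by rewrite expn_gt0; apply/orP; left; apply/card_gt0P; exists 0.
rewrite -(prednK q0) -card_mx -(cardC1 (0 : V)); congr _.+1.
rewrite -(@card_points (predC1 0)) => [|c x c0|].
- by congr (_ * _)%N; apply: eq_card => x; rewrite !inE point_neq0.
- by rewrite !inE scaler_eq0 (negPf c0).
- by rewrite !inE eqxx.
Qed.

Lemma card_field_gt1 : (1 < q)%N.
Proof. exact: finNzRing_gt1. Qed.

Definition nonorth (x y : point) := sform (val x) (val y) != 0.

Lemma nonorth_sym : symmetric nonorth.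
Proof. by move=> x y; rewrite /nonorth sformC oppr_eq0. Qed.

Lemma nonorth_irrefl : irreflexive nonorth.
Proof. by move=> x; rewrite /nonorth sformxx eqxx. Qed.

Lemma card_nonorth (x : point) : (#|[set y | nonorth x y]| * q = q ^ (m * 2))%N.
Proof.
have q1 : (0 < q.-1)%N by have := card_field_gt1; lia.
apply/eqP; rewrite -(eqn_pmul2l q1) -card_mx; apply/eqP.
have sform_surj c : exists y, sform (val x) y = c.
  have [y xy] : exists y, sform (val x) y != 0.
    apply/existsP; apply: contraNT (point_neq0 x) => /existsPn h.
    by apply/eqP/sform_nondegenerate => y; apply/eqP/negbNE/h.
  by exists ((c / sform (val x) y) *: y); rewrite sformZr divfK.
rewrite -(cardC1 (0 : F)) -(card_preim_additive _ (@sformDr _) sform_surj).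
rewrite mulnA (cardC1 (0 : F)) [(q.-1 * _)%N]mulnC; congr (_ * _)%N.
rewrite -card_points => [|c y c0|].
- by congr (_ * _)%N; apply: eq_card => y; rewrite !inE.
- by rewrite !inE sformZr mulf_eq0 (negPf c0).
- by rewrite !inE sform0r eqxx.
Qed.

(** [z] is not a multiple of [x], so the pair of forms is surjective onto the
[q^2] values, of which [(q - 1)^2] have no zero entry. *)
Lemma card_nonorth2 (x z : point) : x != z ->
  (#|[set y | nonorth x y && nonorth z y]| * q ^ 2 = q.-1 * q ^ (m * 2))%N.
Proof.
move=> xz.
have q1 : (0 < q.-1)%N by have := card_field_gt1; lia.
apply/eqP; rewrite -(eqn_pmul2l q1); apply/eqP; rewrite [in RHS]mulnA mulnn.
pose f y : {ffun bool -> F} := [ffun b => sform (val (if b then x else z)) y].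
have fD : {morph f : u v / u + v}.
  by move=> u v; apply/ffunP => b; rewrite !ffunE sformDr.
have f_surj (w : {ffun bool -> F}) : exists y, f y = w.
  have [u [xu zu]] := sform_dual (point_neq0 x) (point_independent xz).
  have zx : z != x by rewrite eq_sym.
  have [v [zv xv]] := sform_dual (point_neq0 z) (point_independent zx).
  exists (w true *: v + w false *: u); apply/ffunP => b; rewrite !ffunE.
  by rewrite sformDr !sformZr; case: b; rewrite ?xu ?xv ?zu ?zv; ring.
have := @card_preim_additive _ {ffun bool -> F} f
  (ffun_on (predC1 (0 : F))) fD f_surj.
rewrite card_ffun card_ffun_on card_bool cardC1 card_mx => <-.
rewrite mulnA [(q.-1 * _)%N]mulnC; congr (_ * _)%N.
rewrite -card_points => [|c y c0|].
- congr (_ * _)%N; apply: eq_card => y; rewrite !inE.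
  apply/andP/ffun_onP => [[xy zy] b|h]; first by rewrite ffunE inE; case: b.
  by have:= h true; have := h false; rewrite !ffunE !inE.
- rewrite !inE; apply/ffun_onP/ffun_onP => h b; have := h b;
  by rewrite !ffunE !inE sformZr mulf_eq0 (negPf c0).
- rewrite !inE; apply/negP => /ffun_onP /(_ true).
  by rewrite ffunE !inE sform0r eqxx.
Qed.

End Symplectic.

Lemma symplectic_graph (q r : nat) : prime_power q ->
  exists G : sgraph,
    [/\ ((graph_order G * q.-1).+1 = q ^ r.+1.*2)%N,
        graph_regular (q ^ r.*2.+1) G
      & forall x y : vertex G, x != y ->
          #|[set z | adj x z && adj y z]| = (q.-1 * q ^ r.*2)%N].
Proof.
case=> p [a [p_pr a_gt0 ->]]; have [F _ <-] := pPrimePowerField p_pr a_gt0.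
have q0 : (0 < #|F|)%N by have := card_field_gt1 F; lia.
exists (SGraph (@nonorth_sym F r.+1) (@nonorth_irrefl F r.+1)).
split=> [|x|x y xy].
- by rewrite card_point muln2.
- by apply/eqP; rewrite -(eqn_pmul2r q0) card_nonorth muln2 -expnSr.
- apply/eqP; have q20 : (0 < #|F| ^ 2)%N by rewrite expn_gt0 q0.
  by rewrite -(eqn_pmul2r q20) card_nonorth2 // -mulnA -expnD muln2 addn2.
Qed.

Lemma symplectic_order_gt (q r n : nat) :
  (1 < q)%N -> ((n * q.-1).+1 = q ^ r.+1.*2)%N -> (r.+1 < n)%N.
Proof.
move=> q_gt1; rewrite doubleS expnS.
have := ltn_expl r.*2.+1 q_gt1; set t := (q ^ _)%N => lt_rt.
case: q q_gt1 t lt_rt => // q q_gt1 t lt_rt /= nE.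
have: (t <= n)%N by rewrite -(leq_pmul2r (_ : 0 < q)%N) //; lia.
lia.
Qed.

(** * Comparison of the energies with the bounds *)

(** After multiplication by [Q - 1], which eliminates [n], the left-hand side
becomes the square root of [Q (s^2 - 1) (Q s^2 + 1) (Q^2 s^2 - 1)] and the
right-hand side becomes [Q (Q s^3 + Q s^2 - Q s - 1)]; the number [Q^2 s^3]
lies between. *)
Lemma complement_energy_bound (R : realType) (n k Q s : R) :
    2 <= Q -> 2 <= s -> n * (Q - 1) + 1 = Q ^+ 2 * s ^+ 2 ->
    k = n - Q * s ^+ 2 - 1 ->
  Num.sqrt (k * (n - k) * n) < (n - 1) * (s + 1) - Q * s.
Proof.
move=> Q2 s2 nE kE.
have Q1 : 0 < Q - 1 by lra.
have s3 : 0 < s ^+ 3 by apply: exprn_gt0; lra.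
pose z := Q ^+ 2 * s ^+ 3 / (Q - 1).
have z0 : 0 < z by rewrite divr_gt0 // mulr_gt0 // exprn_gt0 //; lra.
apply: (@le_lt_trans _ _ z).
  rewrite -[z]gtr0_norm // -sqrtr_sqr ler_wsqrtr //.
  rewrite -(ler_pM2r (exprn_gt0 2 Q1)).
  have -> : z ^+ 2 * (Q - 1) ^+ 2 = Q ^+ 4 * s ^+ 6 by rewrite /z; field; lra.
  have kQ : k * (Q - 1) = Q * (s ^+ 2 - 1).
    have: Q * (k * (Q - 1) - Q * (s ^+ 2 - 1)) = 0.
      rewrite kE.
      have -> :
        Q * ((n - Q * s ^+ 2 - 1) * (Q - 1) - Q * (s ^+ 2 - 1)) =
        Q * (n * (Q - 1) + 1 - Q ^+ 2 * s ^+ 2) by ring.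
      by rewrite nE subrr mulr0.
    by move/eqP; rewrite mulf_eq0 gt_eqF ?subr_eq0 /=; [move/eqP|lra].
  have -> : k * (n - k) * n * (Q - 1) ^+ 2 =
     (k * (Q - 1)) * (n - k) * (n * (Q - 1)) by ring.
  have -> : n * (Q - 1) = Q ^+ 2 * s ^+ 2 - 1 by rewrite -nE; ring.
  rewrite kQ (_ : n - k = 1 + Q * s ^+ 2); last by rewrite kE; ring.
  pose a := s ^+ 2; have a4 : 4 <= a by rewrite /a; nra.
  have -> : Q ^+ 4 * s ^+ 6 = Q * (Q * a ^+ 2) * (Q ^+ 2 * a).
    by rewrite /a; ring.
  rewrite -/a -[Q * (a - 1) * _]mulrA.
  have h1 : 0 <= (a - 1) * (1 + Q * a) by apply: mulr_ge0; nra.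
  have h2 : (a - 1) * (1 + Q * a) <= Q * a ^+ 2 by nra.
  apply: ler_pM; [|nra| |lra].
    by rewrite mulr_ge0 //; lra.
  by rewrite ler_pM2l //; lra.
rewrite ltr_pdivrMr //.
have -> : ((n - 1) * (s + 1) - Q * s) * (Q - 1) =
  (n * (Q - 1) + 1 - Q) * (s + 1) - Q * (Q - 1) * s by ring.
rewrite nE.
have -> : (Q ^+ 2 * s ^+ 2 - Q) * (s + 1) - Q * (Q - 1) * s =
  Q ^+ 2 * s ^+ 3 + Q * (Q * s * (s - 1) - 1) by ring.
have ss : 2 <= s * (s - 1) by nra.
rewrite ltrDl -[Q * s * _]mulrA mulr_gt0 //; [lra | nra].
Qed.

Theorem proposition13 (R : realType) (q : nat) (hq : prime_power q) :
  (forall n0 : nat, exists (G : sgraph) (n k : nat),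
     [/\ graph_order G = n, (n0 < n)%N, graph_regular k G,
         k%:R = (q%:R - 1) / q%:R * n%:R + 1 / q%:R :> R
       & energy R G =
           k%:R + Num.sqrt (k%:R * (n%:R - k%:R) * (n%:R - 1))])
  /\
  (forall n0 : nat, exists (G : sgraph) (n k : nat),
     [/\ graph_order G = n, (n0 < n)%N, graph_regular k G,
         k%:R = n%:R / q%:R - (q%:R + 1) / q%:R :> R
       & energy R G >
           Num.sqrt (k%:R * (n%:R - k%:R) * n%:R) - n%:R + k%:R + 1]).
Proof.
have q_gt1 : (1 < q)%N.
  case: hq => p [a [p_pr a_gt0 ->]].
  by rewrite -(exp1n a) ltn_exp2r // prime_gt1.
pose Q : R := q%:R; have Q2 : 2 <= Q by rewrite (ler_nat R 2).
have Q0 : Q != 0 by rewrite gt_eqF //; lra.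
(* The vector space has dimension [2 (r + 2)], so that [s = q^(r + 1)] is at
   least 2, as [complement_energy_bound] requires. *)
suff step r : exists G : sgraph,
  let n := graph_order G in let k := (q ^ r.+1.*2.+1)%N in
  [/\ (r < n)%N, (k < n)%N,
      [/\ graph_regular k G,
         k%:R = (Q - 1) / Q * n%:R + 1 / Q
       & energy R G =
           k%:R + Num.sqrt (k%:R * (n%:R - k%:R) * (n%:R - 1))]
    & let G' := complement G in let k' := (n - k.+1)%N in
      [/\ graph_regular k' G',
         k'%:R = n%:R / Q - (Q + 1) / Q
       & energy R G' >
           Num.sqrt (k'%:R * (n%:R - k'%:R) * n%:R) - n%:R + k'%:R + 1]].
  split=> n0; have [G /= [n0n _ GP G'P]] := step n0.
    by exists G, (graph_order G), (q ^ n0.+1.*2.+1)%N; case: GP.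
  exists (complement G), (graph_order G).
  by exists (graph_order G - (q ^ n0.+1.*2.+1).+1)%N; case: G'P.
have [G [nat_nE kG lG]] := symplectic_graph r.+1 hq.
exists G; set n := graph_order G; set k := (q ^ _)%N; cbv zeta.
set l := (_ * _)%N in lG.
have r_n := symplectic_order_gt q_gt1 nat_nE.
pose s : R := Q ^+ r.+1.
have s2 : 2 <= s.
  by rewrite /s /Q -natrX (ler_nat R 2); apply: leq_trans (ltn_expl r.+1 q_gt1).
have s2E : Q ^+ r.+1.*2 = s ^+ 2 by rewrite -muln2 exprM.
have q1E : q.-1%:R = Q - 1 by rewrite -subn1 natrB // ltnW.
have kE : k%:R = Q * s ^+ 2 by rewrite natrX exprS s2E.
have lE : l%:R = (Q - 1) * s ^+ 2 by rewrite natrM q1E natrX s2E.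
have nE : n%:R * (Q - 1) + 1 = Q ^+ 2 * s ^+ 2.
  by rewrite -q1E -natrM natr1 nat_nE natrX doubleS 2!exprS s2E; ring.
have nkE : Q * (n%:R - k%:R) = n%:R - 1.
  have -> : Q * (n%:R - k%:R) = Q * n%:R - Q ^+ 2 * s ^+ 2 by rewrite kE; ring.
  by rewrite -nE; ring.
have n1 : 1 < n%:R :> R by rewrite (ltr_nat R 1); apply: leq_trans r_n.
have k_n : (k < n)%N.
  rewrite -(ltr_nat R) -subr_gt0 -(pmulr_rgt0 _ (_ : 0 < Q)) ?nkE ?subr_gt0 //.
  lra.
have klE : k%:R - l%:R = s ^+ 2 :> R by rewrite kE lE; ring.
split=> //; first exact: ltnW (ltnW r_n).
- split=> //.
    have -> : (Q - 1) / Q * n%:R + 1 / Q = (n%:R * (Q - 1) + 1) / Q by field.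
    by rewrite nE kE; field.
  have A0 : adjacency R G + 0%:M = adjacency R G by rewrite raddf0 addr0.
  rewrite (@energy_design R G 0 k%:R s l%:R) ?A0; [| | | |lra|lra|lra|].
  + rewrite (_ : _ * _ * (n%:R - 1) = ((n%:R - 1) * s) ^+ 2).
      rewrite sqrtr_sqr ger0_norm; first by rewrite -/n; ring.
      by rewrite mulr_ge0 //; lra.
    transitivity (s ^+ 2 * (Q * (n%:R - k%:R)) * (n%:R - 1)).
      by rewrite {1}kE; ring.
    by rewrite nkE; ring.
  + by rewrite -/n; apply: ltn_trans r_n.
  + by rewrite (adjacency_sqr_design R kG lG) klE.
  + exact: adjacency_regular.
  + by rewrite kE; nra.
have k'E : (n - k.+1)%:R = n%:R - Q * s ^+ 2 - 1 :> R.
  by rewrite natrB // -natr1 kE; ring.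
split; first exact: complement_regular.
  rewrite k'E -kE -[k%:R](mulKf Q0).
  have -> : Q * k%:R = Q * n%:R - (n%:R - 1) by rewrite -nkE; ring.
  by field.
have bound := complement_energy_bound Q2 s2 nE k'E.
rewrite (@energy_design R (complement G) 1 (n%:R - k%:R) s
  (n%:R - k%:R *+ 2 + l%:R)); [| | | |lra|lra|lra|].
- rewrite -/n k'E -kE in bound *.
  have -> : 1 * (1 * n%:R - (n%:R - k%:R)) / s = Q * s.
    by rewrite kE; field; lra.
  lra.
- exact: ltn_trans r_n.
- by rewrite (complement_adjacency_sqr R kG lG) klE.
- exact: (complement_adjacency_const R kG).
rewrite -(ltr_pM2l (_ : 0 < Q)) ?nkE; last lra.
rewrite -(ltr_pM2r (_ : 0 < Q - 1)); last lra.
have -> : (n%:R - 1) * (Q - 1) = n%:R * (Q - 1) + 1 - Q by ring.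
rewrite nE -subr_gt0.
have -> : Q ^+ 2 * s ^+ 2 - Q - Q * s * (Q - 1) =
  Q * (Q * (s * (s - 1)) + (s - 1)) by ring.
have ss : 0 < s * (s - 1) by apply: mulr_gt0; lra.
by apply: mulr_gt0; [lra | nra].
Qed.
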